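(* Let $\alpha\in\mathbb{R}$ and let $\chi:\mathbb{R}^+\to\mathbb{R}$ be a kernel such that $\psi_{\chi}^{-}(u)=\alpha$ for every $u\in(1,e)$ and $\chi(u)\neq 0$ for some $u\in(1,e)$. Let $f:\mathbb{R}^{+}\rightarrow\mathbb{R}$ be a bounded measurable function with a non-removable jump discontinuity at $t\in\mathbb{R}^{+}$. Then $(I_w^{\chi}f)(t)$ does not converge (as $w\to\infty$) pointwise at $t$.
   Context: $\mathbb{R}^+$ denotes the positive real numbers. A function $\chi:\mathbb{R}^+\to\mathbb{R}$ is called a kernel if: (i) $\chi\in L^1(\mathbb{R}^+)$ and $\chi$ is bounded on $[1/e,e]$; (ii) $\sum_{k=-\infty}^{+\infty}\chi(e^{-k}u)=1$ for every $u\in\mathbb{R}^+$; (iii) for some $\nu>0$, $\sup_{u\in\mathbb{R}^+}\sum_{k=-\infty}^{+\infty}|\chi(e^{-k}u)|\,|k-\log u|^{\nu}<+\infty$. For $w>0$ and bounded measurable $f:\mathbb{R}^+\to\mathbb{R}$, the Kantorovich exponential sampling series is \[(I_{w}^{\chi}f)(x)= \sum_{k= - \infty}^{+\infty} \chi(e^{-k} x^{w})\, w \int_{k/w}^{(k+1)/w} f(e^{u})\, du,\quad x\in\mathbb{R}^+.\] The one-sided limits are $f(t+0):=\lim_{y\to0^+}f(t+y)$ and $f(t-0):=\lim_{y\to0^+}f(t-y)$; $f$ has a non-removable jump discontinuity at $t$ if both exist, are finite, and are different. For $u\in\mathbb{R}^+$, $\psi_\chi^-(u):=\sum_{k\in\mathbb{Z},\,k>\log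 u}\chi(ue^{-k})$.
   Formalization: The formal theorem assumes in addition t ≠ 1: at t = 1 one has 1^w = 1 and the series always converges, e.g. for χ = 1/2 on [1/e, e), zero elsewhere, and f the indicator function of [1, ∞) it equals 1 for every w, so the claim is false there. *)

(* Defs.v *)
From HB Require Import structures.
From mathcomp Require Import all_boot all_order all_algebra.
From mathcomp Require Import all_classical all_reals all_analysis.

Set Implicit Arguments.
Unset Strict Implicit.
Unset Printing Implicit Defensive.

Import Order.TTheory GRing.Theory Num.Theory.
Import numFieldNormedType.Exports.

Local Open Scope classical_set_scope.
Local Open Scope ring_scope.

(* A function on the positive reals is represented by a function R -> R; only
   its values on `]0, +oo[ are ever used. *)

(* [lebesgueType R] is R with the complete Lebesgue sigma-algebra, so that
   measurability and L^1 are in the sense of Lebesgue and not only of Borel. *)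
Definition lebesgueType (R : realType) :=
  caratheodory_type ((wlength (@idfun R))^*)%mu.

Definition lebesgue_measurable_fun (R : realType) (D : set R) (f : R -> R) :=
  measurable_fun (D : set (lebesgueType R)) (f : lebesgueType R -> R).

Definition zseries_cvg (R : realType) (a : int -> R) : Prop :=
  cvgn (series (fun n : nat => a n%:Z)) /\
  cvgn (series (fun n : nat => a (- n.+1%:Z))).

(* The two-sided series \sum_(k = -oo)^(+oo) a k; meaningful when
   [zseries_cvg a] holds. *)
Definition zseries (R : realType) (a : int -> R) : R :=
  limn (series (fun n : nat => a n%:Z)) +
  limn (series (fun n : nat => a (- n.+1%:Z))).

Record is_kernel (R : realType) (chi : R -> R) : Prop := IsKernel {
  kernel_L1 :
    completed_lebesgue_measure.-integrable
      (`]0, +oo[ : set (lebesgueType R)) (EFin \o chi) ;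
  kernel_bounded :
    [bounded chi u | u in `[(expR 1)^-1, expR 1]] ;
  kernel_sum1 : forall u : R, 0 < u ->
    zseries_cvg (fun k : int => chi (expR (- k%:~R) * u)) /\
    zseries (fun k : int => chi (expR (- k%:~R) * u)) = 1 ;
  kernel_moment : exists2 nu : R, 0 < nu &
    (ereal_sup
      [set \esum_(k in [set: int])
         (`|chi (expR (- k%:~R) * u)| * `|k%:~R - ln u| `^ nu)%:E
      | u in [set u : R | (0 < u)%R]] < +oo)%E
}.

(* The sum in [kantorovich] and the one in [psi_minus] converge absolutely for
   a kernel chi and a bounded measurable f, by [kernel_bounded] and
   [kernel_moment].
   Since 1 `^ w = 1 for every w, [kantorovich chi f w 1] has a limit as
   w --> +oo as soon as f has one-sided limits at 1. *)
Definition kantorovich (R : realType) (chi f : R -> R) (w x : R) : R :=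
  zseries (fun k : int =>
    chi (expR (- k%:~R) * x `^ w) *
    (w * \int[completed_lebesgue_measure]_(
             u in (`[k%:~R / w, (k%:~R + 1) / w] : set (lebesgueType R)))
           f (expR u))).

Definition psi_minus (R : realType) (chi : R -> R) (u : R) : R :=
  zseries (fun k : int =>
    if ln u < k%:~R then chi (u * expR (- k%:~R)) else 0).

Definition jump_discontinuity (R : realType) (f : R -> R) (t : R) : Prop :=
  exists fp fm : R,
    [/\ f (t + y) @[y --> 0^'+] --> fp,
        f (t - y) @[y --> 0^'+] --> fm
      & fp <> fm].

(* Main.v *)
(* Put x = log t <> 0, fix s in ]0, 1[ and let w tend to +oo along parameters
   with w x = m + s, m an integer. After the shift k = j + m, the series at t
   reads \sum_j chi(e^(s - j)) B_j, where B_j is the mean of f(e^u) over an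
   interval of length 1/w lying on the right of x if j > 0, on its left if j < 0,
   and cut by x in the proportions s : 1 - s if j = 0. By dominated convergence
   its limit is
     alpha fp + (1 - alpha) fm + chi(e^s) (1 - s) (fp - fm),
   fp and fm being the one-sided limits of f at t. If the full limit exists, then
   chi(e^s) (1 - s) does not depend on s; letting s tend to 1, where chi is
   bounded, it vanishes, so that chi = 0 on ]1, e[. *)

Require Import Defs.
From mathcomp Require Import all_boot all_order all_algebra.
From mathcomp Require Import all_classical all_reals all_analysis.
From mathcomp Require Import measurable_realfun zify ring lra.
Import Order.TTheory GRing.Theory Num.Theory.
Import numFieldNormedType.Exports.
Local Open Scope classical_set_scope.
Local Open Scope ring_scope.

(** * Two-sided series *)

(** Used in both directions, to take a term out of one half of a two-sided series and to put it into
    the other. *)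
Lemma cvg_series_tail (R : realType) (a : nat -> R) (l : R) :
  (series (fun n => a n.+1) @ \oo --> l - a 0%N) <-> (series a @ \oo --> l).
Proof.
have E n : series a n.+1 = a 0%N + series (fun n => a n.+1) n.
  by rewrite /series /= big_nat_recl.
rewrite -[X in _ <-> X]cvg_shiftS; split => h.
  rewrite -(subrK (a 0%N) l) addrC /=.
  under eq_fun do rewrite E.
  by apply: cvgD h; exact: cvg_cst.
have -> : series (fun n => a n.+1) = (fun n => series a n.+1 - a 0%N).
  by apply/funext => n; rewrite E addrC addKr.
by apply: cvgB h _; exact: cvg_cst.
Qed.

(** The term [a 0] leaves the nonnegative half and enters the negative one, so the two changes of
    the limits cancel. *)
Lemma zseries_shift1 (R : realType) (a : int -> R) : zseries_cvg a ->
  zseries_cvg (fun k => a (k + 1)) /\ zseries (fun k => a (k + 1)) = zseries a.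
Proof.
move=> [/cvg_ex[p /= ap] /cvg_ex[q /= aq]].
have bp : series (fun n : nat => a (n%:Z + 1)) @ \oo --> p - a 0.
  move/cvg_series_tail : ap.
  rewrite (_ : (fun n => a n.+1%:Z) = (fun n => a (n%:Z + 1)))//.
  by apply/funext => n; congr a; lia.
have bq : series (fun n : nat => a (- n.+1%:Z + 1)) @ \oo --> q + a 0.
  apply/cvg_series_tail; rewrite addrK.
  rewrite (_ : (fun n => _) = (fun n => a (- n.+1%:Z)))//.
  by apply/funext => n; congr a; lia.
split; first by split; [exact: (cvgP _ bp)|exact: (cvgP _ bq)].
rewrite /zseries (cvg_lim _ ap)// (cvg_lim _ aq)// (cvg_lim _ bp)//.
by rewrite (cvg_lim _ bq)//; ring.
Qed.

Lemma zseries_shiftN1 (R : realType) (a : int -> R) : zseries_cvg a ->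
  zseries_cvg (fun k => a (k - 1)) /\ zseries (fun k => a (k - 1)) = zseries a.
Proof.
move=> [/cvg_ex[p /= ap] /cvg_ex[q /= aq]].
have bp : series (fun n : nat => a (n%:Z - 1)) @ \oo --> p + a (-1).
  apply/cvg_series_tail; rewrite addrK.
  rewrite (_ : (fun n => _) = (fun n => a n%:Z))//.
  by apply/funext => n; congr a; lia.
have bq : series (fun n : nat => a (- n.+1%:Z - 1)) @ \oo --> q - a (-1).
  move/cvg_series_tail : aq.
  rewrite (_ : (fun n => a (- n.+2%:Z)) = (fun n => a (- n.+1%:Z - 1)))//.
  by apply/funext => n; congr a; lia.
split; first by split; [exact: (cvgP _ bp)|exact: (cvgP _ bq)].
rewrite /zseries (cvg_lim _ ap)// (cvg_lim _ aq)// (cvg_lim _ bp)//.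
by rewrite (cvg_lim _ bq)//; ring.
Qed.

Lemma zseries_shift (R : realType) (m : int) (a : int -> R) : zseries_cvg a ->
  zseries_cvg (fun k => a (k + m)) /\ zseries (fun k => a (k + m)) = zseries a.
Proof.
move=> a_cvg; elim/int_ind: m => [|n [c e]|n [c e]].
- by under eq_fun do rewrite addr0.
- have [c' e'] := zseries_shift1 _ _ c.
  have -> : (fun k => a (k + n.+1%:Z)) = (fun k => a (k + 1 + n%:Z)).
    by apply/funext => k; congr a; lia.
  by rewrite e' e.
- have [c' e'] := zseries_shiftN1 _ _ c.
  have -> : (fun k => a (k - n.+1%:Z)) = (fun k => a (k - 1 - n%:Z)).
    by apply/funext => k; congr a; lia.
  by rewrite e' e.
Qed.

(** * Dominated convergence for series *)

(** Cut at an index [N] beyond which the tail of [A] is at most [e / 2]: the terms past [N]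
    contribute at most [e / 2] for every [n], and the finitely many others tend to 0. *)
Lemma dominated_series0 (R : realType) (d : nat -> nat -> R) (A : nat -> R) :
  cvgn (series A) -> (forall n k, `|d n k| <= A k) ->
  (forall k, d ^~ k @ \oo --> 0) ->
  limn (series (d n)) @[n --> \oo] --> 0.
Proof.
move=> cA dA dl.
have A0 k : 0 <= A k := le_trans (normr_ge0 (d 0%N k)) (dA 0%N k).
have cd n : cvgn [normed series (d n)].
  exact: (series_le_cvg (fun k => normr_ge0 _) A0 (dA n) cA).
apply/cvgr0Pnorm_le => e e0.
have e20 : 0 < e / 2 by lra.
have [N _ AN] := (cvgrPdist_le _ _).1 cA _ e20.
have /= {}AN := AN N (leqnn N).
have key n : `|limn (series (d n))| <= e / 2 + \sum_(0 <= k < N) `|d n k|.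
  apply: le_trans (lim_series_norm (cd n)) _.
  apply: limr_le => //; near=> M.
  have NM : (N <= M)%N by near: M; exists N.
  rewrite /= seriesEnat /= (big_cat_nat (leq0n _) NM)//= addrC lerD2r.
  apply: (le_trans (y := \sum_(N <= k < M) A k)).
    by apply: ler_sum => k _; exact: dA.
  apply: le_trans AN; apply: le_trans (ler_norm _).
  rewrite lerBrDl; have -> : series A N + \sum_(N <= k < M) A k = series A M.
    by rewrite /series /= -big_cat_nat.
  by apply: nondecreasing_cvgn_le => //; exact: nondecreasing_series.
have sumN0 : \sum_(0 <= k < N) `|d n k| @[n --> \oo] --> (0 : R).
  rewrite [X in _ --> X](_ : 0 = \sum_(0 <= k < N) (0 : R)); last first.
    by rewrite big1_eq.
  apply: cvg_big => [|k _]; first exact: add_continuous.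
  rewrite -(normr0 R); exact: cvg_norm.
near=> n.
apply: le_trans (key n) _.
rewrite [leRHS](splitr e) lerD2l; apply: le_trans (ler_norm _) _.
by near: n; move/cvgr0Pnorm_le : sumN0; exact.
Unshelve. all: by end_near. Qed.

(** The limit [l] inherits the bound [A], so the differences [d n - l] are dominated by [2 A] and
    tend to 0 termwise. *)
Lemma dominated_series (R : realType) (d : nat -> nat -> R) (l A : nat -> R) :
  cvgn (series A) -> (forall n k, `|d n k| <= A k) ->
  (forall k, d ^~ k @ \oo --> l k) ->
  limn (series (d n)) @[n --> \oo] --> limn (series l).
Proof.
move=> cA dA dl.
have A0 k : 0 <= A k by exact: le_trans (normr_ge0 _) (dA 0%N k).
have lA k : `|l k| <= A k.
  have h : (fun n => `|d n k|) @ \oo --> `|l k| by exact: cvg_norm.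
  rewrite -(cvg_lim _ h)//.
  by apply: limr_le; [apply/cvg_ex; exists `|l k| | exact: nearW].
have cabs (b : nat -> R) : (forall k, `|b k| <= A k) -> cvgn (series b).
  move=> bA; apply: normed_cvg.
  exact: (series_le_cvg (fun k => normr_ge0 _) A0 bA cA).
apply/subr_cvg0.
rewrite (_ : (fun n => _) = fun n => limn (series (d n - l))); last first.
  by apply/funext => n; rewrite lim_seriesB; [|exact: cabs..].
apply: (@dominated_series0 _ _ (fun k => A k *+ 2)).
- by rewrite -[fun _ => _]/(A *+ 2) mulr2n; apply: is_cvg_seriesD.
- by move=> n k /=; rewrite mulr2n (le_trans (ler_normB _ _))// lerD.
- move=> k /=; rewrite -(subrr (l k)); apply: cvgB => //; exact: cvg_cst.
Qed.

Lemma zseries_dominated (R : realType) (d : nat -> int -> R) (l A : int -> R) :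
  zseries_cvg A -> (forall n k, `|d n k| <= A k) ->
  (forall k, d ^~ k @ \oo --> l k) ->
  zseries (d n) @[n --> \oo] --> zseries l.
Proof.
move=> [Ap An] dA dl.
by apply: cvgD; [apply: dominated_series Ap _ _|apply: dominated_series An _ _].
Qed.

(** * Comparison and linearity of two-sided series *)

Lemma zseries_le_cvg (R : realType) (a A : int -> R) :
  zseries_cvg A -> (forall k, `|a k| <= A k) -> zseries_cvg a.
Proof.
have cabs (b B : nat -> R) : cvgn (series B) -> (forall k, `|b k| <= B k) ->
    cvgn (series b).
  move=> cB bB; apply: normed_cvg.
  exact: (series_le_cvg (fun k => normr_ge0 _)
    (fun k => le_trans (normr_ge0 _) (bB k)) bB cB).
by move=> [Ap An] aA; split; [apply: cabs Ap _|apply: cabs An _].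
Qed.

Lemma zseries_cvgD (R : realType) (a b : int -> R) :
  zseries_cvg a -> zseries_cvg b -> zseries_cvg (fun k => a k + b k).
Proof.
move=> [ap an] [bp bn].
by split; [exact: (is_cvg_seriesD ap bp)|exact: (is_cvg_seriesD an bn)].
Qed.

Lemma zseriesD (R : realType) (a b : int -> R) :
  zseries_cvg a -> zseries_cvg b ->
  zseries (fun k => a k + b k) = zseries a + zseries b.
Proof.
move=> [ap an] [bp bn]; rewrite /zseries.
have Ep := lim_seriesD ap bp; have En := lim_seriesD an bn.
rewrite [X in X + _]Ep [X in _ + X]En; ring.
Qed.

Lemma zseries_cvgZ (R : realType) (x : R) (a : int -> R) : zseries_cvg a ->
  zseries_cvg (fun k => x * a k).
Proof.
move=> [ap an]; split.
- by apply: (is_cvg_seriesZ (k := x) ap).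
- by apply: (is_cvg_seriesZ (k := x) an).
Qed.

Lemma zseriesZ (R : realType) (x : R) (a : int -> R) : zseries_cvg a ->
  zseries (fun k => x * a k) = x * zseries a.
Proof.
move=> [ap an]; rewrite /zseries mulrDr.
rewrite -[X in _ = X + _](lim_seriesZ _ ap).
by rewrite -[X in _ = _ + X](lim_seriesZ _ an).
Qed.

Lemma zseries_delta0 (R : realType) (x : R) :
  zseries_cvg (fun k : int => if k == 0 then x else 0) /\
  zseries (fun k : int => if k == 0 then x else 0) = x.
Proof.
have p : series (fun n : nat => if n%:Z == 0 then x else 0) @ \oo --> x.
  apply/cvg_series_tail; rewrite /= subrr.
  rewrite (_ : series _ = cst 0); first exact: cvg_cst.
  by apply/funext => n; rewrite /series /= big1.
have m : series (fun n : nat => if - n.+1%:Z == 0 then x else 0) @ \oo --> 0.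
  rewrite (_ : series _ = cst 0); first exact: cvg_cst.
  by apply/funext => n; rewrite /series /= big1.
split; first by split; [exact: (cvgP _ p)|exact: (cvgP _ m)].
by rewrite /zseries (cvg_lim _ p)// (cvg_lim _ m)// addr0.
Qed.

(** Each half is indexed by an injection [e] of the naturals into the integers, so its sum is at
    most the unordered sum over all integers. *)
Lemma esum_zseries_cvg (R : realType) (a : int -> R) : (forall k, 0 <= a k) ->
  (\esum_(k in [set: int]) (a k)%:E < +oo)%E -> zseries_cvg a.
Proof.
move=> a0 aoo.
have key (e : nat -> int) : injective e -> cvgn (series (a \o e)).
  move=> e_inj.
  have sm : summable (xpredT : pred nat) (fun n => (a (e n))%:E).
    rewrite /summable (eq_esum (b := fun n => (a (e n))%:E)); last first.
      by move=> n _; rewrite gee0_abs ?lee_fin.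
    apply: le_lt_trans aoo.
    rewrite -(@reindex_esum _ _ _ xpredT (range e) e (fun k => (a k)%:E)).
      rewrite [leRHS](esumID (range e))//; last by move=> k _; rewrite lee_fin.
      by rewrite setTI leeDl// esum_ge0// => k _; rewrite lee_fin.
    split; first by move=> n _; exists n.
      by move=> m n _ _ /e_inj.
    by move=> _ [n _ <-]; exists n.
  by apply: summable_cvg sm => n _; rewrite lee_fin.
split; [apply: (key Posz)|apply: (key (fun n => - n.+1%:Z))].
- by move=> m n [].
- by move=> m n; lia.
Qed.

(** * Integrals of functions close to a step function *)

(* The integral is a difference of suprema over simple functions, hence monotone
   on all functions; this avoids the measurability of f o exp, which would need
   that ln preserves null sets. *)
Lemma le_integral_pointwise d (T : measurableType d) (R : realType)
    (mu : {measure set T -> \bar R}) (D : set T) (f g : T -> \bar R) :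
  (forall x, D x -> (f x <= g x)%E) ->
  (\int[mu]_(x in D) f x <= \int[mu]_(x in D) g x)%E.
Proof.
move=> fg; have le x : ((f \_ D) x <= (g \_ D) x)%E.
  by rewrite /patch; case: ifPn => // /set_mem/fg.
rewrite /integral; apply: leeB; apply: le_ereal_sup => _ [h hle <-];
  exists h => // x; apply: le_trans (hle x) _.
- by rewrite !funeposE ge_max !le_max lexx le orbT.
- by rewrite !funenegE ge_max !le_max lexx orbT leeN2 le.
Qed.

Lemma completed_lebesgue_measure_itv (R : realType) (a b : R) (x y : bool) :
  a <= b -> completed_lebesgue_measure
    [set` Interval (BSide x a) (BSide y b)] = (b - a)%:E.
Proof.
(* The two measures are the same set function on different sigma-algebras, hence convertible on
   [I]. *)
move=> ab; set I := [set` _]; transitivity (lebesgue_measure I) => //.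
rewrite /I lebesgue_measure_itv /= lte_fin EFinB; case: ltP => // ba.
by rewrite (le_anti (introT andP (conj ab ba))) subee.
Qed.

Lemma measurable_lebesgueType (R : realType) (A : set (measurableTypeR R)) :
  measurable A -> measurable (A : set (lebesgueType R)).
Proof. exact: sub_caratheodory. Qed.

(** The point [p] has measure zero. Its own value [c0] lets the step function be compared pointwise
    with functions that are merely bounded at [p]. *)
Lemma integral_two_steps (R : realType) (a p b c c0 c' : R) :
  a <= p -> p <= b ->
  (\int[completed_lebesgue_measure]_(u in (`[a, b] : set (lebesgueType R)))
    (if (u < p :> R)%R then c else if u == p then c0 else c')%:E =
  (c * (p - a) + c' * (b - p))%:E)%E.
Proof.
move=> ap pb.
have mI (i : interval R) : measurable ([set` i] : set (lebesgueType R)).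
  by apply: measurable_lebesgueType; exact: measurable_itv.
pose F := fun u : lebesgueType R =>
  (if (u < p :> R)%R then c else if u == p then c0 else c')%:E.
rewrite -[integral _ _ _]/(\int[completed_lebesgue_measure]_(
  u in (`[a, b] : set (lebesgueType R))) F u)%E.
have -> : (`[a, b]%classic : set (lebesgueType R)) =
    `[a, p[ `|` ([set p] `|` `]p, b]).
  apply/seteqP; split => u /=; rewrite !in_itv /=; last first.
    by move=> [|[->|]]; lra.
  case: (ltgtP u p); [left|right;right|right;left]; lra.
have mF (A : set (lebesgueType R)) : measurable A -> measurable_fun A F.
  move=> mA; apply/measurable_EFinP; apply: measurable_funTS.
  apply: measurable_fun_ifT => //.
  - apply: (measurable_fun_bool true) => /=; rewrite setTI.
    rewrite (_ : _ @^-1` _ = ([set` `]-oo, p[] : set R)); first exact: mI.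
    by apply/seteqP; split => u /=; rewrite in_itv.
  - apply: measurable_fun_ifT => //.
    apply: (measurable_fun_bool true) => /=; rewrite setTI.
    rewrite (_ : _ @^-1` _ = ([set` `[p, p]] : set R)); first exact: mI.
    by apply/seteqP; split => u /=; rewrite in_itv /= -eq_le eq_sym.
have cstF (D : set (lebesgueType R)) r : {in D, F =1 cst r%:E} -> measurable D ->
    (\int[completed_lebesgue_measure]_(u in D) F u =
     r%:E * completed_lebesgue_measure D)%E.
  by move=> /eq_integral -> mD; rewrite integral_cst.
have m1 : measurable ([set` `[p, p]] `|` [set` `]p, b]] : set (lebesgueType R)).
  exact: measurableU (mI _) (mI _).
have m0 := measurableU _ _ (mI `[a, p[) m1.
have d1 : [disjoint ([set` `[p, p]] : set (lebesgueType R)) & [set` `]p, b]]].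
  by apply/disj_setPS => u /= []; rewrite !in_itv /=; lra.
have d0 : [disjoint ([set` `[a, p[] : set (lebesgueType R)) &
    [set` `[p, p]] `|` [set` `]p, b]]].
  by apply/disj_setPS => u /= []; rewrite !in_itv /=; lra.
rewrite -set_itv1 (integral_setU _ (mI _) m1 (mF _ m0) d0).
rewrite (integral_setU _ (mI _) (mI _) (mF _ m1) d1).
rewrite (cstF [set` `[a, p[] c) ?(cstF [set` `[p, p]] c0)
  ?(cstF [set` `]p, b]] c')//.
- rewrite !completed_lebesgue_measure_itv//.
  by rewrite subrr mule0 add0e -!EFinM -EFinD.
- move=> u; rewrite inE /= in_itv /= /F => /andP[pu _].
  by rewrite ltNge (ltW pu) gt_eqF.
- move=> u; rewrite inE /= in_itv /= /F -eq_le => /eqP <-.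
  by rewrite ltxx eqxx.
- by move=> u; rewrite inE /= in_itv /= /F => /andP[_ ->].
Qed.

(** Monotonicity encloses the integral of [h] between those of the step functions with values
    [c - e], [c' - e] and [c + e], [c' + e], set to [- K] and [K] at [p]. *)
Lemma Rintegral_two_steps_approx (R : realType) (h : R -> R)
    (a p b c c' e K : R) :
  a <= p -> p <= b ->
  (forall u, a <= u -> u < p -> `|c - h u| <= e) ->
  (forall u, p < u -> u <= b -> `|c' - h u| <= e) ->
  `|h p| <= K ->
  `|c * (p - a) + c' * (b - p) -
    \int[completed_lebesgue_measure]_(
      u in (`[a, b] : set (lebesgueType R))) h u| <= e * (b - a).
Proof.
move=> ap pb hc hc' hK.
pose I := (\int[completed_lebesgue_measure]_(
  u in (`[a, b] : set (lebesgueType R))) (h u)%:E)%E.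
rewrite [X in `|_ - X|](_ : _ = fine I)//.
have lo : (((c - e) * (p - a) + (c' - e) * (b - p))%:E <= I)%E.
  rewrite -(@integral_two_steps _ _ _ _ _ (- K) _ ap pb).
  apply: le_integral_pointwise => u /=; rewrite in_itv /= => /andP[au ub].
  rewrite lee_fin; case: ltgtP => [up|pu|->].
  - by have := hc u au up; rewrite ler_norml; lra.
  - by have := hc' u pu ub; rewrite ler_norml; lra.
  - by move: hK; rewrite ler_norml; lra.
have hi : (I <= ((c + e) * (p - a) + (c' + e) * (b - p))%:E)%E.
  rewrite -(@integral_two_steps _ _ _ _ _ K _ ap pb).
  apply: le_integral_pointwise => u /=; rewrite in_itv /= => /andP[au ub].
  rewrite lee_fin; case: ltgtP => [up|pu|->].
  - by have := hc u au up; rewrite ler_norml; lra.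
  - by have := hc' u pu ub; rewrite ler_norml; lra.
  - by move: hK; rewrite ler_norml; lra.
(* The two bounds exclude infinite values, so [fine] loses nothing. *)
case: I lo hi => [r| |]//; rewrite !lee_fin /= => lo hi.
by rewrite ler_norml; lra.
Qed.

(** * Limits along parameters with a prescribed fractional part *)

(** The moment condition at [u = e^s] controls the sum of [|chi(e^(s - k))| |k - s|^nu]; as [s] is
    not an integer, the weights are bounded below by a positive constant and can be divided out. *)
Lemma kernel_zseries_cvg_norm (R : realType) (chi : R -> R) (s : R) :
  is_kernel chi -> 0 < s -> s < 1 ->
  zseries_cvg (fun k : int => `|chi (expR (- k%:~R) * expR s)|).
Proof.
move=> [_ _ _ [nu nu0 sup_fin]] s0 s1.
pose q (k : int) := `|chi (expR (- k%:~R) * expR s)| * `|k%:~R - s| `^ nu.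
have q_cvg : zseries_cvg q.
  apply: esum_zseries_cvg => [k|]; first by rewrite mulr_ge0// powR_ge0.
  apply: le_lt_trans sup_fin; apply: ereal_sup_ubound.
  by exists (expR s); [exact: expR_gt0|rewrite expRK].
(* The distance of s to the integers. *)
pose m := Num.min s (1 - s).
have m0 : 0 < m by rewrite lt_min s0 subr_gt0.
have mnu0 : 0 < m `^ nu by exact: powR_gt0.
apply: (zseries_le_cvg _ _ _ (zseries_cvgZ _ (m `^ nu)^-1 _ q_cvg)) => k.
rewrite normr_id ler_pdivlMl// mulrC ler_wpM2l//.
suff km : m <= `|k%:~R - s| by rewrite ge0_ler_powR ?(ltW nu0)// nnegrE ltW.
have [k0|k0] := leP k 0.
  have kR : k%:~R <= 0 :> R by rewrite lerz0.
  by rewrite ler0_norm /m ?ge_min; [apply/orP; left|]; lra.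
have kR : 1 <= k%:~R :> R by rewrite -(mulr1z 1) ler_int; lia.
by rewrite ger0_norm /m ?ge_min; [apply/orP; right|]; lra.
Qed.

(* The mean over [k - s, k + 1 - s] of the step function equal to fm on the left
   of 0 and to fp on its right. *)
Definition jump_mean {R : realType} (fp fm s : R) (k : int) : R :=
  if (k < 0)%R then fm else if k == 0 then s * fm + (1 - s) * fp else fp.

(** When [w ln t = m + s], the interval of integration is [ln t + [j - s, j + 1 - s] / w], which
    shrinks to [ln t] with its position relative to [ln t] fixed by [j] and [s]. The estimate is
    uniform in [m], so it can be used along any sequence of parameters. *)
Lemma jump_mean_limit (R : realType) (f : R -> R) (t s fp fm K : R) (j : int) :
  0 < t -> 0 < s -> s < 1 ->
  (forall x, 0 < x -> `|f x| <= K) ->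
  f (t + y) @[y --> 0^'+] --> fp -> f (t - y) @[y --> 0^'+] --> fm ->
  forall e, 0 < e ->
  \forall w \near +oo, forall m : int, w * ln t = m%:~R + s ->
    `|jump_mean fp fm s j - w * \int[completed_lebesgue_measure]_(
       u in (`[(j + m)%:~R / w, ((j + m)%:~R + 1) / w] : set (lebesgueType R)))
         f (expR u)| <= e.
Proof.
move=> t0 s0 s1 fK ffp ffm e e0.
have [d /= d0 dfp] := (cvgrPdist_le _ _).1 ffp _ e0.
have [d' /= d'0 dfm] := (cvgrPdist_le _ _).1 ffm _ e0.
have [eta /= eta0 etaP] := (cvgrPdist_lt _ _).1 (@continuous_expR R (ln t))
  (Num.min d d') ltac:(by rewrite lt_min d0).
have expRt : expR (ln t) = t by rewrite lnK.
have near_p u : ln t < u -> u < ln t + eta -> `|fp - f (expR u)| <= e.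
  move=> tu ue.
  have tu' : t < expR u by rewrite -{1}expRt ltr_expR.
  have /= := etaP u; rewrite expRt ltr0_norm ?subr_lt0// lt_min.
  move=> /(_ ltac:(lra))/andP[+ _].
  rewrite ltr0_norm ?subr_lt0// => du.
  have := dfp (expR u - t); rewrite /= sub0r normrN gtr0_norm ?subr_gt0//.
  by rewrite subrKC; apply; lra.
have near_m u : u < ln t -> ln t - eta < u -> `|fm - f (expR u)| <= e.
  move=> tu ue.
  have tu' : expR u < t by rewrite -{1}expRt ltr_expR.
  have /= := etaP u; rewrite expRt gtr0_norm ?subr_gt0// lt_min.
  move=> /(_ ltac:(lra))/andP[_ +].
  rewrite gtr0_norm ?subr_gt0// => du.
  have := dfm (t - expR u); rewrite /= sub0r normrN gtr0_norm ?subr_gt0//.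
  by rewrite subKr; apply; lra.
near=> w => m wm.
have w0 : 0 < w by near: w; apply: nbhs_pinfty_gt; exact: num_real.
(* All points of the interval lie within [(|j| + 1) / w] of [ln t]. *)
have weta : (`|j|%:~R + 1) / w < eta.
  rewrite ltr_pdivrMr// mulrC -ltr_pdivrMr//; near: w.
  by apply: nbhs_pinfty_gt; exact: num_real.
set a := _ / w; set b := _ / w.
have bE : b = a + w^-1 by rewrite /a /b mulrDl div1r.
have aE : a = ln t + (j%:~R - s) / w.
  rewrite /a intrD; apply: (mulfI (lt0r_neq0 w0)).
  by rewrite mulrDr wm !mulrA ![w * _]mulrC !mulfK ?gt_eqF//; lra.
clearbody a b.
have iw0 : 0 < w^-1 by rewrite invr_gt0.
have wV : w * w^-1 = 1 by rewrite divff ?gt_eqF.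
have jeta : `|j|%:~R * w^-1 + w^-1 < eta by move: weta; rewrite mulrDl div1r.
have jle : j%:~R <= `|j|%:~R :> R by rewrite ler_int ler_norm.
have jge : - `|j|%:~R <= j%:~R :> R.
  by rewrite -mulrNz ler_int lerNl -normrN ler_norm.
have aeta : ln t - eta < a.
  rewrite aE; have := ler_wpM2r (ltW iw0) (_ : - (`|j|%:~R + 1) <= j%:~R - s).
  rewrite mulNr mulrDl mul1r => /(_ ltac:(clear -jge s1; lra)).
  by clear -jeta; lra.
have beta : b < ln t + eta.
  rewrite bE aE; have := ler_wpM2r (ltW iw0) (_ : j%:~R - s <= `|j|%:~R).
  by move=> /(_ ltac:(clear -jle s0; lra)); clear -jeta; lra.
(* The position of [p] relative to [ln t] is constrained only on a side of positive length, so [p]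
   may be an endpoint of an interval lying on one side of [ln t]. *)
have approx p : a <= p -> p <= b ->
    (a < p -> p <= ln t) -> (p < b -> ln t <= p) ->
    `|fm * (p - a) + fp * (b - p) - \int[completed_lebesgue_measure]_(
      u in (`[a, b] : set (lebesgueType R))) f (expR u)| <= e * (b - a).
  move=> ap pb apt ptb.
  apply: (@Rintegral_two_steps_approx _ (f \o expR) _ _ _ _ _ _ K) => //=.
  - move=> u au up; have pt := apt (le_lt_trans au up).
    by apply: near_m; [exact: lt_le_trans up pt|exact: lt_le_trans aeta au].
  - move=> u pu ub; have tp := ptb (lt_le_trans pu ub).
    by apply: near_p; [exact: le_lt_trans tp pu|exact: le_lt_trans ub beta].
  - by apply: fK; exact: expR_gt0.
(* The interval [a, b] is cut at ln t if j = 0, and at an endpoint otherwise. *)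
have [p [ap pb apt ptb pE]] : exists p, [/\ a <= p, p <= b, a < p -> p <= ln t,
    p < b -> ln t <= p &
    jump_mean fp fm s j = w * (fm * (p - a) + fp * (b - p))].
  rewrite /jump_mean; have [j0|j0|j0] := ltgtP j 0.
  - have jR : j%:~R <= -1 :> R by rewrite -(mulrN1z 1) ler_int; clear -j0; lia.
    exists b; split; rewrite ?ltxx//; [by rewrite bE lerDl ltW| |].
      rewrite bE aE; have := ler_wpM2r (ltW iw0) (_ : j%:~R - s <= -1).
      rewrite mulN1r => /(_ ltac:(clear -jR s0; lra)) jw _; clear -jw; lra.
    by rewrite bE subrr mulr0 addr0 addrAC subrr add0r mulrCA wV mulr1.
  - have jR : 1 <= j%:~R :> R by rewrite -(mulr1z 1) ler_int; clear -j0; lia.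
    exists a; split; rewrite ?ltxx//; [by rewrite bE lerDl ltW| |].
      rewrite aE => _; have := mulr_ge0 (_ : 0 <= j%:~R - s) (ltW iw0).
      by move=> /(_ ltac:(clear -jR s1; lra)); rewrite lerDl.
    by rewrite bE subrr mulr0 add0r addrAC subrr add0r mulrCA wV mulr1.
  - have aE0 : a = ln t - s * w^-1 by rewrite aE j0 sub0r mulNr.
    have sw0 := mulr_gt0 s0 iw0.
    have sw1 : s * w^-1 < w^-1 by rewrite gtr_pMl.
    exists (ln t); split => //;
      [by rewrite aE0; clear -sw0; lra|by rewrite bE aE0; clear -sw1; lra|].
    rewrite bE aE0.
    rewrite (_ : w * _ = (w * w^-1) * (s * fm + (1 - s) * fp)); last by ring.
    by rewrite wV mul1r.
have H := approx p ap pb apt ptb.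
rewrite pE -mulrBr normrM gtr0_norm//; apply: le_trans (ler_wpM2l (ltW w0) H) _.
by rewrite bE addrAC subrr add0r mulrCA wV mulr1.
Unshelve. all: by end_near. Qed.

(** After the shift the coefficients [c k] no longer depend on [n], and [K |c k|] is a majorant. In
    the limit, [jump_mean] is [fm], plus [fp - fm] for [k > 0], plus [(1 - s) (fp - fm)] at [k = 0];
    these parts give the sums [1], [alpha] and the single term [chi(e^s)]. *)
Lemma kantorovich_cvg_subseq (R : realType) (alpha : R) (chi f : R -> R)
    (t s fp fm K : R) (m : nat -> int) (w : nat -> R) :
  is_kernel chi -> psi_minus chi (expR s) = alpha ->
  0 < s -> s < 1 -> 0 < t ->
  (forall x, 0 < x -> `|f x| <= K) ->
  f (t + y) @[y --> 0^'+] --> fp -> f (t - y) @[y --> 0^'+] --> fm ->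
  (forall n, 0 < w n) -> (forall n, w n * ln t = (m n)%:~R + s) ->
  w @ \oo --> +oo ->
  kantorovich chi f (w n) t @[n --> \oo] -->
    alpha * fp + (1 - alpha) * fm + chi (expR s) * (1 - s) * (fp - fm).
Proof.
move=> kchi psi s0 s1 t0 fK ffp ffm w0 wm woo.
pose c (k : int) := chi (expR (- k%:~R) * expR s).
have c_cvg : zseries_cvg (fun k => `|c k|) by exact: kernel_zseries_cvg_norm.
have [] := kernel_sum1 kchi (expR_gt0 s); rewrite -/c => cc c1.
pose B n (j : int) := w n * \int[completed_lebesgue_measure]_(
  u in (`[(j + m n)%:~R / w n, ((j + m n)%:~R + 1) / w n]
    : set (lebesgueType R))) f (expR u).
have BK n j : `|B n j| <= K.
  rewrite /B; set a := _ / w n; set b := _ / w n.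
  have ab : b - a = (w n)^-1 by rewrite /a /b -mulrBl addrAC subrr add0r div1r.
  have iw0 : 0 < (w n)^-1 by rewrite invr_gt0.
  have hK u : `|0 - f (expR u)| <= K by rewrite sub0r normrN fK ?expR_gt0.
  (* Approximation by the zero function with error [K] yields the bound on the mean. *)
  have := @Rintegral_two_steps_approx R (f \o expR) a b b 0 0 K K
    ltac:(by rewrite -subr_ge0 ab ltW) (lexx b) (fun u _ _ => hK u)
    (fun u _ _ => hK u) (fK _ (expR_gt0 _)).
  rewrite !mul0r addr0 sub0r normrN ab normrM gtr0_norm// => H.
  by rewrite -ler_pdivlMl// mulrC.
have Bl j : B n j @[n --> \oo] --> jump_mean fp fm s j.
  apply/cvgrPdist_le => e e0.
  have := woo _ (jump_mean_limit _ f t s fp fm K j t0 s0 s1 fK ffp ffm e e0).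
  rewrite /= /nbhs /=; apply: filterS => n h; apply: (h (m n)); exact: wm.
have dcvg n : zseries_cvg (fun k => c k * B n k).
  apply: (zseries_le_cvg _ _ _ (zseries_cvgZ _ K _ c_cvg)) => k.
  by rewrite normrM mulrC ler_wpM2r.
have kE n : kantorovich chi f (w n) t = zseries (fun k => c k * B n k).
  have [_ <-] := zseries_shift _ (- m n) _ (dcvg n).
  rewrite /kantorovich; congr zseries; apply/funext => k; congr (_ * _).
    rewrite /c; congr chi; rewrite /powR gt_eqF// wm -!expRD; congr expR.
    by rewrite intrD mulrNz; ring.
  by rewrite /B subrK.
under eq_fun do rewrite kE.
suff -> : alpha * fp + (1 - alpha) * fm + chi (expR s) * (1 - s) * (fp - fm) =
    zseries (fun k => c k * jump_mean fp fm s k).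
  apply: (zseries_dominated _ _ _ (fun k => K * `|c k|)).
  - exact: zseries_cvgZ.
  - by move=> n k; rewrite normrM mulrC ler_wpM2r.
  - by move=> k; apply: cvgM; [exact: cvg_cst|exact: Bl].
pose c' k := if (0 < k)%R then c k else 0.
have c'_cvg : zseries_cvg c'.
  apply: (zseries_le_cvg _ _ _ c_cvg) => k; rewrite /c'.
  by case: ifPn; rewrite ?normr0.
have c'E : zseries c' = alpha.
  rewrite -psi /psi_minus expRK; congr zseries; apply/funext => k.
  rewrite /c' /c mulrC; congr (if _ then _ else _).
  (* For an integer [k] and [0 < s < 1], [s < k] amounts to [0 < k]. *)
  apply/idP/idP => k0.
    apply: (lt_le_trans s1); rewrite -(mulr1z 1) ler_int; clear -k0; lia.
  rewrite ltNge; apply/negP => k0'.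
  have : k%:~R <= 0 :> R by rewrite lerz0.
  by clear -k0 s0; lra.
have [dl_cvg dlE] := zseries_delta0 _ (chi (expR s) * (1 - s) * (fp - fm)).
have -> : (fun k => c k * jump_mean fp fm s k) =
    (fun k => (fm * c k + (fp - fm) * c' k) +
      if k == 0 then chi (expR s) * (1 - s) * (fp - fm) else 0).
  apply/funext => k; rewrite /jump_mean /c'.
  have [k0|k0|->] := ltgtP k 0.
  - by ring.
  - by ring.
  - by rewrite /c oppr0 expR0 mul1r; ring.
have fmc := zseries_cvgZ _ fm _ cc.
have fpc' := zseries_cvgZ _ (fp - fm) _ c'_cvg.
have sum_cvg : zseries_cvg (fun k => fm * c k + (fp - fm) * c' k).
  exact: zseries_cvgD.
rewrite (zseriesD _ _ _ sum_cvg dl_cvg) (zseriesD _ _ _ fmc fpc') dlE.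
by rewrite !zseriesZ// c1 c'E; ring.
Qed.

(** * Comparison of the limits for different fractional parts *)

Lemma unbounded_seq_with_fraction (R : realType) (x s : R) :
  x != 0 -> 0 < s -> s < 1 ->
  exists m : nat -> int, exists w : nat -> R,
    [/\ forall n, 0 < w n, forall n, w n * x = (m n)%:~R + s & w @ \oo --> +oo].
Proof.
move=> x0 s0 s1.
(* [m n + s] has the sign of [x]. The successor makes this strict for [x < 0], since [s < 1], and
   keeps [|m n + s|] at least [n]. *)
pose m n : int := if 0 < x then n.+1%:Z else - n.+1%:Z.
pose w n : R := ((m n)%:~R + s) / x.
have wE n : w n * x = (m n)%:~R + s by rewrite mulfVK.
have nw n : n%:R * `|x|^-1 <= w n.
  rewrite /w /m; have [xp|xn] := ltP 0 x.
    rewrite gtr0_norm// ler_pM2r ?invr_gt0// -[n.+1%:~R]/(n.+1%:R) -natr1.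
    by rewrite -addrA lerDl; lra.
  have {}xn : x < 0 by rewrite lt_neqAle x0.
  rewrite ltr0_norm// invrN mulrN -mulNr ler_nM2r ?invr_lt0//.
  by rewrite mulrNz -[n.+1%:~R]/(n.+1%:R) -natr1; lra.
have w0 n : 0 < w n.
  rewrite /w /m; have [xp|xn] := ltP 0 x.
    by rewrite divr_gt0// ltr_wpDl// ler0z.
  have {}xn : x < 0 by rewrite lt_neqAle x0.
  rewrite ltr_ndivlMr// mul0r mulrNz -[n.+1%:~R]/(n.+1%:R) -natr1.
  by have := ler0n R n; lra.
exists m, w; split => //.
apply/cvgryPge => A.
have /cvgryPge/(_ (A * `|x|)) := @cvgr_idn R.
apply: filterS => n An; apply: le_trans (nw n).
by rewrite ler_pdivlMr ?normr_gt0.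
Qed.

(* The case t = 1 is excluded because the claim is false there: for
   chi = 1/2 on [1/e, e[, chi = 0 elsewhere, and f the indicator function of
   [1, +oo[, all the other hypotheses hold with alpha = 1/2 and t = 1, and the
   series at 1 is equal to 1 for every w > 0. *)
Theorem theorem4 (R : realType) (alpha : R) (chi : R -> R)
  (chi_kernel : is_kernel chi)
  (psi_alpha : forall u : R, 1 < u -> u < expR 1 -> psi_minus chi u = alpha)
  (chi_neq0 : exists u : R, [/\ 1 < u, u < expR 1 & chi u <> 0])
  (f : R -> R)
  (f_bounded : [bounded f x | x in (`]0, +oo[ : set R)])
  (f_measurable : lebesgue_measurable_fun `]0, +oo[ f)
  (t : R) (t_gt0 : 0 < t) (t_neq1 : t <> 1)
  (f_jump : jump_discontinuity f t) :
  ~ cvg (kantorovich chi f w t @[w --> +oo]).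
Proof.
move=> /cvg_ex[l /= kl].
have [fp [fm [ffp ffm fpm]]] := f_jump.
(* Boundedness gives a bound by every number strictly above [K], hence by [K + 1]. *)
have [K [_ /(_ (K + 1) ltac:(by rewrite ltrDl))]] := f_bounded.
move=> /= fK'.
have fK x : 0 < x -> `|f x| <= K + 1.
  by move=> x0; apply: fK'; rewrite /= in_itv /= x0.
have [M [_ /(_ (M + 1) ltac:(by rewrite ltrDl)) /= chiM]] :=
  kernel_bounded chi_kernel.
(* Since [t] differs from 1, [w ln t] can be given any fractional part with [w] arbitrarily
   large. *)
have lnt0 : ln t != 0 by rewrite ln_eq0//; apply/eqP.
pose C := l - alpha * fp - (1 - alpha) * fm.
(* The limit along the sequence attached to [s] must be [l], whatever [s] is. *)
have chiC s : 0 < s -> s < 1 -> chi (expR s) * (1 - s) * (fp - fm) = C.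
  move=> s0 s1.
  have psi : psi_minus chi (expR s) = alpha.
    by apply: psi_alpha; rewrite ?expR_gt1// ltr_expR.
  have [m [w [w0 wm woo]]] := unbounded_seq_with_fraction _ _ _ lnt0 s0 s1.
  have := kantorovich_cvg_subseq _ _ _ _ _ _ _ _ _ _ _
    chi_kernel psi s0 s1 t_gt0 fK ffp ffm w0 wm woo.
  have := cvg_comp _ _ woo kl.
  move=> /cvg_unique h /h; rewrite /C => -> //; ring.
have C0 : C = 0.
  apply/eqP; apply: contraT; rewrite -normr_gt0 => C_gt0.
  pose B := (M + 1) * `|fp - fm|.
  (* Take [s = 1 - r]: then [e^s] lies in [[1/e, e]], where [chi] is bounded. *)
  have CB r : 0 < r -> r < 1 -> `|C| <= B * r.
    move=> r0 r1; rewrite -(chiC (1 - r)); [|lra..].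
    rewrite !normrM subKr (gtr0_norm r0) mulrAC ler_wpM2r ?(ltW r0)//.
    rewrite ler_wpM2r//; apply: chiM => /=.
    by rewrite in_itv /= -expRN !ler_expR; lra.
  have B0 : 0 <= B.
    by have := CB 2^-1 ltac:(lra) ltac:(lra); lra.
  have D0 : 0 < 1 + B + `|C| by lra.
  (* This [r] lies in []0, 1[], and [|C| <= B r] would force [1 + B + |C| <= B]. *)
  have := CB (`|C| / (1 + B + `|C|)) (divr_gt0 C_gt0 D0).
  rewrite ltr_pdivrMr// mul1r => /(_ ltac:(lra)).
  by rewrite mulrA ler_pdivlMr// mulrC ler_pM2r//; lra.
have [u [u1 ue /eqP chiu]] := chi_neq0.
have u0 : 0 < u by lra.
have s0 : 0 < ln u by rewrite ln_gt0.
have s1 : ln u < 1 by rewrite -ltr_expR lnK.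
have /eqP := chiC _ s0 s1; rewrite C0 lnK// !mulf_eq0 (negbTE chiu) !subr_eq0/=.
by case/orP => /eqP; [lra|].
Qed.
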